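(* Fix $\alpha\in(0,1)$, and let the arrival rate $\lambda(t)$ alternate between $\lambda$ (valleys of duration $T_v$) and $a\lambda$ with $a>1$ (peaks of duration $T_p$), where $rT_p/T_v<1$. Let $\pi$ be a policy with $\bar\alpha^\pi_{\mathrm{eff}}\ge\alpha$. Then there exist $\eta\ge0$ and $w\ge0$ such that $$n\ \ge\ n_{\mathrm{dp}}+n_{\mathrm{cp},\eta}-w\cdot\frac{T_R^2a\lambda}{T_p}\qquad\text{and}\qquad m\ \ge\ n_{\mathrm{cv},\eta},$$ where: (I) if $\alpha\lambda_{\mathrm{avg}}\le\lambda$, then $\eta=0$ and $w=0$; (II) if $\alpha\lambda_{\mathrm{avg}}\in\left(\lambda,\frac{\lambda}{1-rT_p/T_v}\right]$, then $\eta\in\left[0,\ \alpha-\frac{\lambda}{\lambda_{\mathrm{avg}}}\left(1+\frac{aT_R}{T_v}\right)\right]$ and $w=1$; (III) if $\alpha\lambda_{\mathrm{avg}}>\frac{\lambda}{1-rT_p/T_v}$, then $\eta\in\left[0,\ \frac{\alpha rT_p}{T_v}-\frac{a\lambda T_R}{T_v\lambda_{\mathrm{avg}}}\right]$ and $w=1$.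
   Context: System: $n$ electric vehicles, $m$ chargers, average trip time $T_R>0$, discharge rate $r_d>0$ while driving, charge rate $r_c>r_d$, $r=r_d/r_c\in(0,1)$. The arrival rate is periodic with period $T_v+T_p$: for $i=0,1,2,\dots$, $\lambda(t)=\lambda$ on $[i(T_v+T_p),\,i(T_v+T_p)+T_v)$ (valley) and $\lambda(t)=a\lambda$ on $[i(T_v+T_p)+T_v,\,(i+1)(T_v+T_p))$ (peak), with $a>1$, $\lambda>0$. $T_v$ and $T_p$ are integer multiples of $T_R$. The average arrival rate is $\lambda_{\mathrm{avg}}=\frac{T_v+aT_p}{T_v+T_p}\lambda$. A policy $\pi$ induces an effective arrival rate (rate of served requests) $0\le\lambda^\pi_{\mathrm{eff}}(t)\le\lambda(t)$, a number of customers in the system $q(t)\ge0$ and a number of charging vehicles $c_C(t)\ge0$ satisfying, for all $t>0$, $$q(t)\ge\int_{\max\{0,t-T_R\}}^t\lambda^\pi_{\mathrm{eff}}(s)\,ds,\qquad \bar c_C\,r_c\ge\bar q\,r_d,\qquad c_C(t)\le\min\{m,n-q(t)\},$$ where $\bar q=\limsup_{T\to\infty}\frac1T\int_0^Tq(t)\,dt$ and $\bar c_C=\liminf_{T\to\infty}\frac1T\int_0^Tc_C(t)\,dt$ are the long-run averages. The service level is $\bar\alpha^\pi_{\mathrm{eff}}=\frac1{\lambda_{\mathrm{avg}}}\limsup_{T\to\infty}\frac1T\int_0^T\lambda^\pi_{\mathrm{eff}}(t)\,dt$. With $x^+=\max\{x,0\}$ define $$\alpha_v=\frac{\lambda T_v-(\lambda-\alpha\lambda_{\mathrm{avg}})^+T_v}{\lambda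 T_v},\qquad \alpha_p=\frac{\alpha\lambda_{\mathrm{avg}}T_p+(\alpha\lambda_{\mathrm{avg}}-\alpha_v\lambda)^+T_v}{a\lambda T_p},$$ and, for $\eta\ge0$, $$n_{\mathrm{dp}}=\alpha_pa\lambda T_R,\qquad n_{\mathrm{cp},\eta}=r\alpha\lambda_{\mathrm{avg}}T_R-\eta\frac{T_v}{T_p}\lambda_{\mathrm{avg}}T_R,\qquad n_{\mathrm{cv},\eta}=r\alpha\lambda_{\mathrm{avg}}T_R+\eta\lambda_{\mathrm{avg}}T_R .$$
   Formalization: In (II) and (III) the upper endpoint x of the interval for η is replaced by max{x,0}, so η=0 when x<0; as printed the interval is then empty and the claim fails, e.g. T_R=T_v=T_p=1, λ=1, a=2, r=1/2, α=0.7 gives x=-1.3. *)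

(* Defs.v *)
From HB Require Import structures.
From mathcomp Require Import all_boot all_order all_algebra.
From mathcomp Require Import all_classical all_reals all_analysis.
Set Implicit Arguments. Unset Strict Implicit. Unset Printing Implicit Defensive.
Import Order.TTheory GRing.Theory Num.Theory.
Import numFieldNormedType.Exports.
Local Open Scope classical_set_scope.
Local Open Scope ring_scope.

(* The arrival rate is constrained only at times t >= 0, where the valley and
   peak conditions determine it completely. *)
Record ev_system (R : realType) := EVSystem {
  vehicles : nat;
  chargers : nat;
  trip_time : R;
  discharge_rate : R;
  charge_rate : R;
  lambda : R;
  peak_factor : R;
  Tv : R;
  Tp : R;
  arrival_rate : R -> R;
  trip_time_gt0 : 0 < trip_time;
  discharge_rate_gt0 : 0 < discharge_rate;
  discharge_lt_charge : discharge_rate < charge_rate;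
  lambda_gt0 : 0 < lambda;
  peak_factor_gt1 : 1 < peak_factor;
  Tv_gt0 : 0 < Tv;
  Tp_gt0 : 0 < Tp;
  Tv_multiple : exists k : nat, Tv = k%:R * trip_time;
  Tp_multiple : exists k : nat, Tp = k%:R * trip_time;
  arrival_rate_valley : forall (i : nat) (t : R),
    i%:R * (Tv + Tp) <= t < i%:R * (Tv + Tp) + Tv -> arrival_rate t = lambda;
  arrival_rate_peak : forall (i : nat) (t : R),
    i%:R * (Tv + Tp) + Tv <= t < i.+1%:R * (Tv + Tp) ->
    arrival_rate t = peak_factor * lambda
}.

Definition upper_average (R : realType) (f : R -> R) : \bar R :=
  limf_esup (fun T : R =>
    (T^-1)%:E * \int[lebesgue_measure]_(t in `[0%R, T]) (f t)%:E)%E (pinfty_nbhs R).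

Definition lower_average (R : realType) (f : R -> R) : \bar R :=
  limf_einf (fun T : R =>
    (T^-1)%:E * \int[lebesgue_measure]_(t in `[0%R, T]) (f t)%:E)%E (pinfty_nbhs R).

(* A policy enters only through the trajectories it induces; they are
   real-valued, so integer-valued counts and fluid quantities are both covered. *)
Record policy (R : realType) (S : ev_system R) := Policy {
  lambda_eff : R -> R;
  customers : R -> R;
  charging : R -> R;
  lambda_eff_measurable : measurable_fun `[(0 : R), +oo[ lambda_eff;
  customers_measurable : measurable_fun `[(0 : R), +oo[ customers;
  charging_measurable : measurable_fun `[(0 : R), +oo[ charging;
  lambda_eff_bounds : forall t : R, 0 <= t -> 0 <= lambda_eff t <= arrival_rate S t;
  customers_ge0 : forall t : R, 0 <= t -> 0 <= customers t;
  charging_ge0 : forall t : R, 0 <= t -> 0 <= charging t;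
  customers_ge : forall t : R, 0 < t ->
    (\int[lebesgue_measure]_(s in `[Num.max 0%R (t - trip_time S)%R, t]) (lambda_eff s)%:E
       <= (customers t)%:E)%E;
  energy_balance :
    (upper_average customers * (discharge_rate S)%:E
       <= lower_average charging * (charge_rate S)%:E)%E;
  charging_le : forall t : R, 0 < t ->
    charging t <= Num.min (chargers S)%:R ((vehicles S)%:R - customers t)
}.

Section Quantities.
Variables (R : realType) (S : ev_system R).

Definition pos_part (x : R) : R := Num.max x 0.

Definition rate_ratio : R := discharge_rate S / charge_rate S.

Definition lambda_avg : R :=
  (Tv S + peak_factor S * Tp S) / (Tv S + Tp S) * lambda S.

Definition service_level (pi : policy S) : \bar R :=
  ((lambda_avg^-1)%:E * upper_average (lambda_eff pi))%E.

Definition alpha_v (alpha : R) : R :=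
  (lambda S * Tv S - pos_part (lambda S - alpha * lambda_avg) * Tv S)
    / (lambda S * Tv S).

Definition alpha_p (alpha : R) : R :=
  (alpha * lambda_avg * Tp S
     + pos_part (alpha * lambda_avg - alpha_v alpha * lambda S) * Tv S)
    / (peak_factor S * lambda S * Tp S).

Definition n_dp (alpha : R) : R :=
  alpha_p alpha * peak_factor S * lambda S * trip_time S.

Definition n_cp (alpha eta : R) : R :=
  rate_ratio * alpha * lambda_avg * trip_time S
    - eta * (Tv S / Tp S) * lambda_avg * trip_time S.

Definition n_cv (alpha eta : R) : R :=
  rate_ratio * alpha * lambda_avg * trip_time S + eta * lambda_avg * trip_time S.

End Quantities.

(* Main.v *)
Require Import Defs.
From mathcomp Require Import all_boot all_order all_algebra.
From mathcomp Require Import all_classical all_reals all_analysis.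
From mathcomp Require Import measurable_realfun ring lra.
Set Implicit Arguments.
Unset Strict Implicit.
Unset Printing Implicit Defensive.
Import Order.TTheory GRing.Theory Num.Theory.
Import numFieldNormedType.Exports.
Local Open Scope classical_set_scope.
Local Open Scope ring_scope.

(** Write [X = alpha * lambda_avg] for the rate of served requests that the
    policy guarantees, [P = Tv + Tp] for the period, [T] for the trip time,
    [L] and [a L] for the valley and peak rates, and [Lam t] for the number of
    requests served up to time [t].

    Counting customers.  Since [customers t >= Lam t - Lam (t - T)], integrating
    over [s, e] and shifting the second term leaves two windows of length
    [T], one at each end; as [Lam] is nondecreasing and [a L]-Lipschitz, the
    integral of [customers] is at least [T (Lam e - Lam s) - a L T^2]
    ([occupancy_ge]).  On [0, t] the last term is negligible, so the number
    of customers has upper average at least [T X], and the energy balance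
    gives the number of charging vehicles a lower average at least [r T X].
    An upper average is approached along some unbounded set of horizons, a lower
    average controls all late horizons, so both bounds hold at once on some
    late horizon; rounding it up to the end of a period costs only a bounded
    amount, absorbed by a slack [e] ([full_periods_horizon]).

    On such a horizon of [K] periods four bounds follow, letting [e] tend
    to [0]:
    - [m >= r T X], as at most [m] vehicles charge;
    - [n >= T X + r T X], adding customers and charging vehicles;
    - [n Tp >= T (X P - L Tv)]: at most [L Tv] requests are served per valley,
      so the peaks serve the rest, and a peak is a whole number of windows of
      length [T], each serving at most [n] requests;
    - [n Tp + m Tv >= T (X P - L Tv) - a L T^2 + r T X P]: the valleys offer
      [m Tv] of charging time, and the peaks offer [n Tp] to share between
      charging and the customers served in the peak.

    The first two settle [X <= L].  Otherwise take for [eta] the excess of [m]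
    over [r T X], measured in units of [lambda_avg T]; the fourth bound is then
    the claim on [n].  If this [eta] exceeds the permitted maximum, use the
    maximum instead: the bound on [m] only becomes weaker, and at the maximum
    the bound on [n] follows from the second one in the intermediate regime,
    from the third one in the top regime ([eta_choice]). *)

(** * Upper and lower limits at infinity *)

Section UpperLowerLimitsAtInfinity.
Context {R : realType}.
Implicit Types (f : R -> \bar R) (x M : R).

Lemma limf_esup_frequently {f x} M : (x%:E < limf_esup f (pinfty_nbhs R))%E ->
  exists2 X, M < X & (x%:E < f X)%E.
Proof.
move=> xf.
have : (x%:E < ereal_sup (f @` [set X | (M < X)%R]))%E.
  apply: (lt_le_trans xf); apply: ereal_inf_lbound.
  by exists [set X | (M < X)%R] => //; exists M; split => //; exact: num_real.
by move=> /ereal_sup_gt[_ [X MX <-] xX]; exists X.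
Qed.

Lemma frequently_limf_esup {f x} :
  (forall M, exists2 X, M < X & (x%:E <= f X)%E) ->
  (x%:E <= limf_esup f (pinfty_nbhs R))%E.
Proof.
move=> fx; apply: le_ereal_inf_tmp => _ [V [M [_ MV]] <-].
have [X MX xX] := fx M; apply: (le_trans xX); apply: ereal_sup_ubound.
by exists X => //; exact: MV.
Qed.

Lemma limf_einf_eventually {f x} : (x%:E < limf_einf f (pinfty_nbhs R))%E ->
  exists M, forall X, M < X -> (x%:E < f X)%E.
Proof.
rewrite limf_einfE => /ereal_sup_gt[_ [V [M [_ MV]] <-] xV].
exists M => X MX; apply: (lt_le_trans xV); apply: ereal_inf_lbound.
by exists X => //; exact: MV.
Qed.

End UpperLowerLimitsAtInfinity.


(** * Elementary real inequalities *)

Lemma le_of_slack {R : realType} (k x y : R) : 0 < k ->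
  (forall e, 0 < e -> x <= y + k * e) -> x <= y.
Proof.
move=> k0 xy; apply/ler_addgt0Pr => e e0.
have := xy (e / k) (divr_gt0 e0 k0).
by rewrite mulrC divfK ?gt_eqF.
Qed.

Lemma telescope_le {R : realType} (G : R -> R) (s d D : R) (K : nat) :
  (forall i : nat, G (s + i.+1%:R * d) - G (s + i%:R * d) <= D) ->
  G (s + K%:R * d) - G s <= K%:R * D.
Proof.
move=> GD; elim: K => [|K IH]; first by rewrite !mul0r addr0 subrr.
have -> : K.+1%:R * D = K%:R * D + D by rewrite -natr1; ring.
by have := GD K; lra.
Qed.

Lemma period_index {R : realType} (d t : R) : 0 < d -> 0 <= t ->
  exists i : nat, i%:R * d <= t < i.+1%:R * d.
Proof.
move=> d0 t0; exists (Num.truncn (t / d)).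
by rewrite -ler_pdivlMr// -ltr_pdivrMr//; apply/truncn_itv/divr_ge0/ltW.
Qed.

(** * Integrals over segments *)

Section SegmentIntegrals.
Context {R : realType}.
Implicit Types (f g h : R -> R) (a b c k : R).
Local Notation mu := (@lebesgue_measure R).

(** Integrability on every segment is what the bounded trajectories and the
    unbounded but monotone cumulative counts have in common. *)
Definition segment_integrable f :=
  forall a b, mu.-integrable `[a, b] (EFin \o f).

Definition segint f a b := \int[mu]_(t in `[a, b]) f t.

Lemma measurable_segment_integrable f : measurable_fun setT f ->
  (forall a b, exists M, forall t, a <= t <= b -> `|f t| <= M) ->
  segment_integrable f.
Proof.
move=> mf bf a b; apply: measurable_bounded_integrable => //.
- by rewrite /= lebesgue_measure_itv/=; case: ifP => // _; rewrite -EFinB ltry.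
- exact: measurable_funTS.
- have [M fM] := bf a b.
  exists M; split; first exact: num_real.
  move=> N MN t /=; rewrite in_itv/= => tab.
  exact: le_trans (fM t tab) (ltW MN).
Qed.

Lemma bounded_segment_integrable f k : measurable_fun setT f ->
  (forall t, 0 <= f t <= k) -> segment_integrable f.
Proof.
move=> mf fk; apply: measurable_segment_integrable => // a b; exists k => t _.
by have /andP[f0 ?] := fk t; rewrite ger0_norm.
Qed.

Lemma nondecreasing_segment_integrable f : {homo f : x y / x <= y} ->
  segment_integrable f.
Proof.
move=> ndf; apply: measurable_segment_integrable.
  exact: nondecreasing_measurable.
move=> a b; exists (`|f a| + `|f b|) => t /andP[at_ tb].
have := ndf _ _ at_; have := ndf _ _ tb.
have := ler_norm (f b); have := ler_norm (- f a); rewrite normrN.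
rewrite ler_norml; have := normr_ge0 (f a); have := normr_ge0 (f b).
by move=> *; apply/andP; split; lra.
Qed.

Lemma segment_integrableD f g : segment_integrable f -> segment_integrable g ->
  segment_integrable (fun t => f t + g t).
Proof. by move=> fi gi a b; apply: (integrableD _ (fi a b) (gi a b)). Qed.

Lemma segment_integrableB f g : segment_integrable f -> segment_integrable g ->
  segment_integrable (fun t => f t - g t).
Proof. by move=> fi gi a b; apply: (integrableB _ (fi a b) (gi a b)). Qed.

Lemma segment_integrable_cst k : segment_integrable (fun=> k).
Proof. exact: (@nondecreasing_segment_integrable (fun=> k)). Qed.

Lemma segint_cst k a b : a <= b -> segint (fun=> k) a b = k * (b - a).
Proof.
move=> ab; rewrite /segint Rintegral_cst//= lebesgue_measure_itv/= lte_fin.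
by move: ab; rewrite le_eqVlt => /predU1P[->|->//]; rewrite ltxx/= subrr.
Qed.

Lemma segintD f g a b : segment_integrable f -> segment_integrable g ->
  segint (fun t => f t + g t) a b = segint f a b + segint g a b.
Proof. by move=> fi gi; rewrite /segint RintegralD. Qed.

Lemma segintB f g a b : segment_integrable f -> segment_integrable g ->
  segint (fun t => f t - g t) a b = segint f a b - segint g a b.
Proof. by move=> fi gi; rewrite /segint RintegralB. Qed.

Lemma segint_cat f c a b : segment_integrable f -> a <= c -> c <= b ->
  segint f a b = segint f a c + segint f c b.
Proof.
move=> fi ac cb; rewrite /segint.
have := @Rintegral_itvB R f (BLeft a) (BRight b) c (fi a b).
rewrite !bnd_simp => /(_ ac cb) E.
rewrite -[X in _ + X]Rintegral_itv_obnd_cbnd -?E ?subrKC//.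
by apply: integrableS (fi c b) => //; apply: subset_itvr; rewrite bnd_simp.
Qed.

(** Only the half-open segment is compared: the rate allowed in a valley holds
    up to, but not at, the instant where the next peak starts. *)
Lemma le_segint f g a b : segment_integrable f -> segment_integrable g ->
  (forall t, a <= t < b -> f t <= g t) -> segint f a b <= segint g a b.
Proof.
move=> fi gi fg.
have coI h : segment_integrable h -> mu.-integrable `[a, b[ (EFin \o h).
  move=> hi; apply: integrableS (hi a b) => //.
  by apply: subset_itvl; rewrite bnd_simp.
rewrite /segint -!Rintegral_itv_bndo_bndc; [|exact: coI..].
apply: le_Rintegral; [by []|exact: coI|exact: coI|].
by move=> t /=; rewrite in_itv/=; exact: fg.
Qed.

Lemma segint_ge0 f a b : (forall t, 0 <= f t) -> 0 <= segint f a b.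
Proof. by move=> f0; apply: Rintegral_ge0. Qed.

Lemma segint_eq0 f a b : b <= a -> segint f a b = 0.
Proof.
rewrite le_eqVlt /segint => /predU1P[->|ba].
  by rewrite set_itv1 Rintegral_set1.
by rewrite set_itv_ge ?Rintegral_set0// bnd_simp -ltNge.
Qed.

(** An instance of integration by substitution, whence the continuity of the
    integrand. *)
Lemma segint_shift f k a b : continuous f -> a <= b ->
  segint (fun t => f (t - k)) a b = segint f (a - k) (b - k).
Proof.
move=> cf ab; rewrite /segint /Rintegral; congr fine.
have dF (x : R) : is_derive x (1 : R) (fun t : R => t - k) (1 : R).
  exact: (is_derive_shift x 1 (- k)).
have F'E : derive1 (fun t : R => t - k) = cst 1.
  by apply/funext => x; rewrite derive1E derive_val.
have cF x : {for x, continuous (fun t : R => t - k)}.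
  by apply: continuousB => //; exact: cst_continuous.
rewrite (@integration_by_substitution_increasing R (fun t => t - k) f a b) //=.
- by apply: eq_integral => x _; rewrite F'E /= mulr1.
- by move=> x y _ _; rewrite ltrD2r.
- by move=> x _; rewrite F'E; exact: cst_continuous.
- by rewrite F'E; exact: is_cvg_cst.
- by rewrite F'E; exact: is_cvg_cst.
- split=> [x _||]; first exact: ex_derive.
    by apply: cvg_at_right_filter; exact: cF.
  by apply: cvg_at_left_filter; exact: cF.
- exact: continuous_subspaceT.
Qed.

End SegmentIntegrals.

(** * Cumulative counts and occupancy *)

Section CumulativeCount.
Context {R : realType}.
Variables (f : R -> R) (B : R).
Implicit Types a b k s e x y T : R.
Hypothesis mf : measurable_fun setT f.
Hypothesis fB : forall t, 0 <= f t <= B.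

(** For negative [x] the segment is empty and the value is 0, so that the
    window from [max 0 (t - T)] to [t] carries [cumul t - cumul (t - T)] even when
    [t < T]. *)
Definition cumul (x : R) := segint f 0 x.

Let f_int : segment_integrable f.
Proof. exact: bounded_segment_integrable fB. Qed.

Let B_ge0 : 0 <= B.
Proof. by have /andP[] := fB 0; exact: le_trans. Qed.

Lemma cumulB a b : 0 <= a -> a <= b -> cumul b - cumul a = segint f a b.
Proof. by move=> a0 ab; rewrite /cumul (@segint_cat _ _ a)// addrC addKr. Qed.

Lemma cumul_ge0 x : 0 <= cumul x.
Proof. by apply: segint_ge0 => t; have /andP[] := fB t. Qed.

Lemma cumul_increment k a b : 0 <= a -> a <= b ->
  (forall t, a <= t < b -> f t <= k) -> cumul b - cumul a <= k * (b - a).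
Proof.
move=> a0 ab fk; rewrite cumulB// -segint_cst//.
by apply: le_segint => //; exact: segment_integrable_cst.
Qed.

Lemma cumul_nondecreasing : {homo cumul : x y / x <= y}.
Proof.
move=> x y xy; have [x0|x0] := ltP x 0.
  by rewrite {1}/cumul segint_eq0 ?cumul_ge0// ltW.
rewrite -subr_ge0 cumulB//.
by apply: segint_ge0 => t; have /andP[] := fB t.
Qed.

Lemma cumul_lipschitz x y : x <= y -> cumul y - cumul x <= B * (y - x).
Proof.
move=> xy; have fB' t : f t <= B by have /andP[] := fB t.
have [x0|x0] := leP 0 x; first exact: cumul_increment.
rewrite {2}/cumul segint_eq0 ?subr0 ?(ltW x0)//.
have [y0|y0] := leP 0 y; last first.
  by rewrite /cumul segint_eq0 ?(ltW y0)// mulr_ge0// subr_ge0.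
have := @cumul_increment B 0 y (lexx _) y0 (fun t _ => fB' t).
rewrite {2}/cumul segint_eq0// !subr0 => /le_trans; apply.
by rewrite ler_wpM2l// lerDl oppr_ge0 ltW.
Qed.

Lemma cumul_continuous : continuous cumul.
Proof.
move=> x; apply/cvgrPdist_le => /= e e0.
have B1 : 0 < B + 1 by rewrite ltr_wpDl.
have d0 : 0 < e / (B + 1) by rewrite divr_gt0.
near=> y.
have yx : `|x - y| <= e / (B + 1).
  by near: y; apply: cvgr_dist_le.
suff : `|cumul x - cumul y| <= B * `|x - y|.
  move=> /le_trans; apply; apply: (@le_trans _ _ (B * (e / (B + 1)))).
    exact: ler_wpM2l.
  rewrite mulrCA ler_piMr ?(ltW e0)// ler_pdivrMr// mul1r.
  by rewrite lerDl.
have [xy|xy] := leP x y.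
  rewrite distrC [X in B * X]distrC !ger0_norm ?subr_ge0//.
    exact: cumul_lipschitz.
  exact: cumul_nondecreasing.
rewrite !ger0_norm ?subr_ge0 ?(ltW xy)//; last exact/cumul_nondecreasing/ltW.
exact/cumul_lipschitz/ltW.
Unshelve. all: by end_near. Qed.

(** Each request stays for a time [T], hence contributes [T] to the integral of
    [q], except for those that arrive in the last window: they number at most
    [B * T] and lose at most [T] each.  Shifting the integral of
    [cumul (t - T)] makes this precise, as everything but the two extreme windows
    [e - T, e] and [s - T, s] cancels. *)
Lemma occupancy_ge (q : R -> R) (T s e : R) :
    segment_integrable q -> 0 <= T -> s <= e ->
    (forall t, cumul t - cumul (t - T) <= q t) ->
  T * (cumul e - cumul s) - B * T ^+ 2 <= segint q s e.
Proof.
move=> qi T0 se qge.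
have cumul_nd := cumul_nondecreasing.
have ci : segment_integrable cumul by exact: nondecreasing_segment_integrable.
have ciT : segment_integrable (fun t => cumul (t - T)).
  apply: nondecreasing_segment_integrable => x y xy.
  by apply: cumul_nd; rewrite lerD2r.
have: segint (fun t => cumul t - cumul (t - T)) s e <= segint q s e.
  by apply: le_segint => //; exact: segment_integrableB.
apply: le_trans.
rewrite segintB// segint_shift//; last exact: cumul_continuous.
have := @segint_cat _ cumul s (s - T) e ci.
rewrite (@segint_cat _ cumul (e - T) (s - T) e ci) ?lerD2r ?gerBl//.
move=> /(_ T0 se) cat.
(* [cumul] is monotone: bound it by [cumul s] and by [cumul (e - T)]. *)
have hi : segint cumul (s - T) s <= T * cumul s.
  rewrite mulrC; have -> : cumul s * T = cumul s * (s - (s - T)) by ring.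
  rewrite -segint_cst ?gerBl//.
  apply: le_segint => //; first exact: segment_integrable_cst.
  by move=> t /andP[_ /ltW]; exact: cumul_nd.
have lo : T * cumul (e - T) <= segint cumul (e - T) e.
  rewrite mulrC; have -> : cumul (e - T) * T = cumul (e - T) * (e - (e - T)).
    by ring.
  rewrite -segint_cst ?gerBl//.
  apply: le_segint => //; first exact: segment_integrable_cst.
  by move=> t /andP[+ _]; exact: cumul_nd.
have lip : T * (cumul e - cumul (e - T)) <= T * (B * T).
  rewrite ler_wpM2l//; have := @cumul_lipschitz (e - T) e.
  by rewrite gerBl subKr; exact.
lra.
Qed.

End CumulativeCount.

(** * Trajectories cut off at time zero *)

Section StartedTrajectory.
Context {R : realType}.
Implicit Types (g : R -> R) (B s t X : R).

(** The fleet and charger limits hold at positive times only.  Setting a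
    trajectory to 0 up to time 0 makes them hold everywhere and changes no
    integral over positive times. *)
Definition started g := g \_ `]0%R, +oo[.

Lemma startedE g t : 0 < t -> started g t = g t.
Proof. by move=> t0; rewrite /started patchE mem_set//= in_itv/= t0. Qed.

Lemma started_le0 g t : t <= 0 -> started g t = 0.
Proof.
move=> t0; rewrite /started patchE memNset//= in_itv/= andbT.
by apply/negP; rewrite -leNgt.
Qed.

Lemma measurable_started g :
  measurable_fun `[(0 : R), +oo[ g -> measurable_fun setT (started g).
Proof.
move=> mg; have mi : measurable (`]0%R, +oo[%classic : set R) by [].
apply/(measurable_restrictT g mi); apply: measurable_funS mg => //.
by apply: subset_itvr; rewrite bnd_simp.
Qed.

Lemma integral_started g B s X : measurable_fun `[(0 : R), +oo[ g ->
    (forall t, 0 <= started g t <= B) -> 0 <= s ->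
  (\int[lebesgue_measure]_(t in `[s, X]) (g t)%:E =
   (segint (started g) s X)%:E)%E.
Proof.
move=> mg gB s0; have ms := measurable_started mg.
have si := bounded_segment_integrable ms gB.
rewrite /segint /Rintegral fineK; last first.
  by apply: integrable_fin_num => //; exact: si.
rewrite -!integral_itv_obnd_cbnd; last 2 first.
- exact/measurable_EFinP/measurable_funTS.
- apply/measurable_EFinP; apply: (measurable_funS _ _ mg) => //.
  by move=> t /=; rewrite !in_itv/= andbT => /andP[/ltW/(le_trans s0)].
apply: eq_integral => t; rewrite inE/= in_itv/= => /andP[st _].
by rewrite startedE// (le_lt_trans s0).
Qed.

Lemma average_started g B X : measurable_fun `[(0 : R), +oo[ g ->
    (forall t, 0 <= started g t <= B) ->
  ((X^-1)%:E * \int[lebesgue_measure]_(t in `[0%R, X]) (g t)%:E =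
   (cumul (started g) X / X)%:E)%E.
Proof.
by move=> mg gB; rewrite (@integral_started _ B)// -EFinM mulrC.
Qed.

End StartedTrajectory.

(** * Rates of the system *)

Section SystemConstants.
Context {R : realType}.
Variable S : ev_system R.
Local Notation L := (lambda S).
Local Notation a := (peak_factor S).
Local Notation P := (Tv S + Tp S).

Lemma period_gt0 : 0 < P.
Proof. by rewrite addr_gt0 ?Tv_gt0 ?Tp_gt0. Qed.

Lemma peak_rate_gt0 : 0 < a * L.
Proof. by rewrite mulr_gt0 ?lambda_gt0// (lt_trans _ (peak_factor_gt1 S)). Qed.

Lemma lambda_avg_gt0 : 0 < lambda_avg S.
Proof.
rewrite /lambda_avg mulr_gt0 ?lambda_gt0// divr_gt0 ?period_gt0//.
rewrite addr_gt0 ?Tv_gt0// mulr_gt0 ?Tp_gt0//.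
exact: lt_trans (peak_factor_gt1 S).
Qed.

Lemma rate_ratio_gt0 : 0 < rate_ratio S.
Proof.
have rd := discharge_rate_gt0 S.
by rewrite divr_gt0// (lt_trans rd (discharge_lt_charge S)).
Qed.

Lemma arrival_rate_le t : 0 <= t -> arrival_rate S t <= a * L.
Proof.
move=> t0; have P0 := period_gt0.
have [i /andP[it ti]] := period_index P0 t0.
have [tv|tv] := ltP t (i%:R * P + Tv S); last first.
  by rewrite (@arrival_rate_peak _ S i) ?tv.
rewrite (@arrival_rate_valley _ S i) ?it// ler_peMl ?(ltW (lambda_gt0 S))//.
exact/ltW/peak_factor_gt1.
Qed.

End SystemConstants.

(** * Trajectories induced by a policy *)

Section InducedTrajectories.
Context {R : realType} {S : ev_system R} (pi : policy S).
Local Notation T := (trip_time S).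
Local Notation L := (lambda S).
Local Notation a := (peak_factor S).
Local Notation n := ((vehicles S)%:R : R).
Local Notation m := ((chargers S)%:R : R).
Local Notation r := (rate_ratio S).
Local Notation P := (Tv S + Tp S).

Definition served := started (lambda_eff pi).
Definition present := started (customers pi).
Definition plugged := started (charging pi).

Lemma served_bounds t : 0 <= served t <= a * L.
Proof.
have [t0|t0] := leP t 0.
  by rewrite /served started_le0// lexx ltW// peak_rate_gt0.
rewrite /served startedE//.
have /andP[-> /le_trans->//] := lambda_eff_bounds pi (ltW t0).
exact/arrival_rate_le/ltW.
Qed.

Lemma served_valley (i : nat) t : i%:R * P <= t < i%:R * P + Tv S ->
  served t <= L.
Proof.
move=> tv; have [t0|t0] := leP t 0.
  by rewrite /served started_le0// ltW// lambda_gt0.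
rewrite /served startedE//.
have /andP[_] := lambda_eff_bounds pi (ltW t0).
by rewrite (arrival_rate_valley tv).
Qed.

Lemma present_plugged_bounds t :
  [/\ 0 <= present t, 0 <= plugged t, present t + plugged t <= n
    & plugged t <= m].
Proof.
rewrite /present /plugged; have [t0|t0] := leP t 0.
  by rewrite !started_le0// addr0.
rewrite !startedE//; have := charging_le pi t0; rewrite le_min => /andP[cm cn].
have q0 := customers_ge0 pi (ltW t0); have c0 := charging_ge0 pi (ltW t0).
by split=> //; lra.
Qed.

Lemma present_bounds t : 0 <= present t <= n.
Proof.
by have [? ? ? ?] := present_plugged_bounds t; apply/andP; split; lra.
Qed.

Lemma plugged_bounds t : 0 <= plugged t <= m.
Proof.
by have [? ? ? ?] := present_plugged_bounds t; apply/andP; split; lra.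
Qed.

Let measurable_served := measurable_started (lambda_eff_measurable pi).
Let measurable_present := measurable_started (customers_measurable pi).
Let measurable_plugged := measurable_started (charging_measurable pi).

Lemma present_integrable : segment_integrable present.
Proof. exact: bounded_segment_integrable measurable_present present_bounds. Qed.

Lemma plugged_integrable : segment_integrable plugged.
Proof. exact: bounded_segment_integrable measurable_plugged plugged_bounds. Qed.

Let cumulB_served := cumulB measurable_served served_bounds.

Lemma served_window_le t : cumul served t - cumul served (t - T) <= present t.
Proof.
have T0 := trip_time_gt0 S.
have [t0|t0] := leP t 0.
  rewrite /present started_le0// /cumul !segint_eq0 ?subrr//.
  by rewrite (le_trans _ t0)// gerBl ltW.
have := customers_ge pi t0.
rewrite (integral_started _ (lambda_eff_measurable pi) served_bounds);
  last by rewrite le_max lexx.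
rewrite lee_fin /present startedE//; apply: le_trans.
have [tT|tT] := leP 0 (t - T).
  by rewrite cumulB_served// gerBl ltW.
by rewrite {2}/cumul segint_eq0 ?(ltW tT)// subr0.
Qed.

(** All requests of a window of length [T] are present together at its end. *)
Lemma served_window_le_vehicles t : cumul served (t + T) - cumul served t <= n.
Proof.
have := served_window_le (t + T); rewrite addrK => /le_trans; apply.
by have /andP[] := present_bounds (t + T).
Qed.

Lemma present_segint_ge s e : s <= e ->
  T * (cumul served e - cumul served s) - a * L * T ^+ 2 <= segint present s e.
Proof.
move=> se; have T0 := ltW (trip_time_gt0 S).
exact: (occupancy_ge measurable_served served_bounds present_integrable T0 se
  served_window_le).
Qed.

Lemma fleet_segint_le s e : s <= e ->
  segint present s e + segint plugged s e <= n * (e - s).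
Proof.
move=> se; have li := present_integrable; have ci := plugged_integrable.
rewrite -segintD// -segint_cst//; apply: le_segint.
- exact: segment_integrableD.
- exact: segment_integrable_cst.
- by move=> t _; have [] := present_plugged_bounds t.
Qed.

Lemma plugged_segint_le s e : s <= e -> segint plugged s e <= m * (e - s).
Proof.
move=> se; rewrite -segint_cst//; apply: le_segint.
- exact: plugged_integrable.
- exact: segment_integrable_cst.
- by move=> t _; have /andP[] := plugged_bounds t.
Qed.

Lemma served_valley_le (i : nat) :
  cumul served (i%:R * P + Tv S) - cumul served (i%:R * P) <= Tv S * L.
Proof.
have iP0 : 0 <= i%:R * P by rewrite mulr_ge0// ltW// period_gt0.
have le_s : i%:R * P <= i%:R * P + Tv S by rewrite lerDl ltW// Tv_gt0.
have := cumul_increment measurable_served served_bounds iP0 le_s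
  (@served_valley i).
by move=> /le_trans; apply; rewrite le_eqVlt; apply/orP; left; apply/eqP; ring.
Qed.

(** A peak is a whole number of windows of length [T]; this is exact, whereas
    integrating the number of customers would lose [a L T^2]. *)
Lemma served_peak_le s :
  T * (cumul served (s + Tp S) - cumul served s) <= n * Tp S.
Proof.
have [k TpE] := Tp_multiple S.
have := @telescope_le R (cumul served) s T n k.
rewrite -TpE => /(_ _) tele.
have {tele} : cumul served (s + Tp S) - cumul served s <= k%:R * n.
  apply: tele => i; have := served_window_le_vehicles (s + i%:R * T).
  by rewrite -natr1 mulrDl mul1r addrA.
move=> /(ler_wpM2l (ltW (trip_time_gt0 S))) /le_trans; apply.
by rewrite TpE; lra.
Qed.

(** In the valley charging is limited by the chargers; in the peak charging
    and customers together are limited by the fleet.  The term [T * (L * Tv)]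
    accounts for the requests served in the valley, the last one for those
    still in service when the peak ends. *)
Lemma period_resources (i : nat) :
  (cumul plugged (i.+1%:R * P) + T * cumul served (i.+1%:R * P))
    - (cumul plugged (i%:R * P) + T * cumul served (i%:R * P))
  <= n * Tp S + m * Tv S + T * (L * Tv S) + a * L * T ^+ 2.
Proof.
have Tv0 := Tv_gt0 S; have Tp0 := Tp_gt0 S.
have iP0 : 0 <= i%:R * P by rewrite mulr_ge0// ltW// period_gt0.
have := served_valley_le i.
set s := i%:R * P in iP0 *; have -> : i.+1%:R * P = s + Tv S + Tp S.
  by rewrite -natr1 mulrDl mul1r addrA.
have sv : s <= s + Tv S by rewrite lerDl ltW.
have vp : s + Tv S <= s + Tv S + Tp S by rewrite lerDl ltW.
have sv0 := le_trans iP0 sv.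
have := plugged_segint_le sv; have := fleet_segint_le vp.
have := present_segint_ge vp.
rewrite -(cumulB measurable_plugged plugged_bounds iP0 sv).
rewrite -(cumulB measurable_plugged plugged_bounds sv0 vp).
have -> : s + Tv S - s = Tv S by ring.
have -> : s + Tv S + Tp S - (s + Tv S) = Tp S by ring.
move=> present_ge fleet_le plugged_le.
move=> /(ler_wpM2l (ltW (trip_time_gt0 S))).
lra.
Qed.

(** * Resources forced by the service level *)

Section ServiceLevel.
Variable alpha : R.
Hypothesis alpha_gt0 : 0 < alpha.
Hypothesis hservice : (alpha%:E <= service_level pi)%E.
Local Notation X := (alpha * lambda_avg S).

Let X0 : 0 < X. Proof. by rewrite mulr_gt0// lambda_avg_gt0. Qed.

Lemma served_frequently e M : 0 < e ->
  exists2 t, M < t & (X - e) * t <= cumul served t.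
Proof.
move=> e0.
have : ((X - e)%:E < upper_average (lambda_eff pi))%E.
  move: hservice; rewrite /service_level lee_pdivlMl ?lambda_avg_gt0// -EFinM.
  by apply: lt_le_trans; rewrite lte_fin mulrC ltrBlDr ltrDl.
move=> /(limf_esup_frequently (Num.max M 0))[t].
rewrite gt_max => /andP[Mt t0].
rewrite (average_started _ (lambda_eff_measurable pi) served_bounds) lte_fin.
by rewrite ltr_pdivlMr// => /ltW; exists t.
Qed.

Lemma customers_average_ge : ((T * X)%:E <= upper_average (customers pi))%E.
Proof.
have T0 := trip_time_gt0 S; have aL := peak_rate_gt0 S.
apply/lee_subgt0Pr => e e0; rewrite -EFinB; apply: frequently_limf_esup => M.
have e1 : 0 < e / (2 * T) by rewrite divr_gt0// mulr_gt0.
pose N := a * L * T ^+ 2 / (e / 2).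
have [t] := served_frequently (Num.max M (Num.max 0 N)) e1.
rewrite !gt_max => /andP[Mt /andP[t0 Nt]] st; exists t => //.
rewrite (average_started _ (customers_measurable pi) present_bounds) lee_fin.
rewrite ler_pdivlMr//.
have := @present_segint_ge 0 t (ltW t0).
rewrite -/(cumul present t) {2}/cumul segint_eq0// subr0; apply: le_trans.
have : a * L * T ^+ 2 <= t * (e / 2).
  by rewrite -ler_pdivrMr ?divr_gt0// ltW.
have := ler_wpM2l (ltW T0) st.
have -> : T * ((X - e / (2 * T)) * t) = T * X * t - t * (e / 2).
  by field; rewrite gt_eqF.
lra.
Qed.

Lemma charging_average_ge :
  ((r * T * X)%:E <= lower_average (charging pi))%E.
Proof.
have rd0 := discharge_rate_gt0 S.
have rc0 : 0 < charge_rate S := lt_trans rd0 (discharge_lt_charge S).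
have -> : r * T * X = T * X * discharge_rate S / charge_rate S.
  by rewrite /rate_ratio; ring.
rewrite EFinM lee_pdivrMr//; apply: le_trans (energy_balance pi).
rewrite EFinM; apply: lee_wpmul2r; first by rewrite lee_fin ltW.
exact: customers_average_ge.
Qed.

Lemma plugged_eventually e : 0 < e ->
  exists M, forall t, M < t -> (r * T * X - e) * t <= cumul plugged t.
Proof.
move=> e0.
have : ((r * T * X - e)%:E < lower_average (charging pi))%E.
  by apply: lt_le_trans charging_average_ge; rewrite lte_fin ltrBlDr ltrDl.
move=> /limf_einf_eventually[M cM]; exists (Num.max M 0) => t.
rewrite gt_max => /andP[Mt t0]; have := cM t Mt.
rewrite (average_started _ (charging_measurable pi) plugged_bounds) lte_fin.
by rewrite ltr_pdivlMr// => /ltW.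
Qed.

(** The service level is an upper average and the charging a lower one, so
    their bounds hold together on some arbitrarily late horizon.  Rounding it up
    to a multiple of the period keeps the served count and lengthens the
    horizon by at most one period. *)
Lemma full_periods_horizon e M : 0 < e -> exists K : nat,
  [/\ 0 < K%:R * P, M <= K%:R * P,
      (X - e) * (K%:R * P) <= cumul served (K%:R * P)
    & (r * T * X - e) * (K%:R * P) <= cumul plugged (K%:R * P)].
Proof.
move=> e0; have P0 := period_gt0 S.
have e2 : 0 < e / 2 by rewrite divr_gt0.
have [M1 cM1] := plugged_eventually e0.
have [t] := served_frequently
  (Num.max (Num.max M 0) (Num.max M1 (X * P / (e / 2)))) e2.
rewrite !gt_max => /andP[/andP[Mt t0] /andP[M1t Nt]] st.
have [i /andP[it ti]] := period_index P0 (ltW t0).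
have {}it : i.+1%:R * P <= t + P by rewrite -natr1 mulrDl mul1r; lra.
exists i.+1; split.
- exact: lt_trans ti.
- exact/ltW/(lt_trans Mt).
- have := cumul_nondecreasing measurable_served served_bounds (ltW ti).
  apply: le_trans; apply: le_trans st.
  move: Nt; rewrite ltr_pdivrMr// => Nt.
  move: (i.+1%:R * P) ti it => Y ti it.
  have := ler_wpM2l (ltW X0) it; have := ler_wpM2l (ltW e0) (ltW ti).
  lra.
- exact/cM1/(lt_trans M1t).
Qed.

Lemma chargers_ge_mean : r * T * X <= m.
Proof.
apply: (@le_of_slack _ 1) => // e e0; rewrite mul1r.
have [K [KP0 _ _ cK]] := full_periods_horizon 0 e0.
have := plugged_segint_le (ltW KP0); rewrite -/(cumul plugged _) subr0.
move=> /(le_trans cK); rewrite ler_pM2r//; lra.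
Qed.

(** The horizon is taken so late that the boundary term [a L T^2] of the
    occupancy is below the slack. *)
Lemma vehicles_ge_mean : T * X + r * T * X <= n.
Proof.
have T0 := trip_time_gt0 S.
apply: (@le_of_slack _ (T + 2)) => [|e e0]; first by rewrite addr_gt0.
have [K [KP0 NK sK cK]] := full_periods_horizon (a * L * T ^+ 2 / e) e0.
have := fleet_segint_le (ltW KP0); rewrite -/(cumul plugged _) subr0.
have := present_segint_ge (ltW KP0).
rewrite [cumul _ 0]segint_eq0// subr0.
move: NK; rewrite ler_pdivrMr// => NK.
have := ler_wpM2l (ltW T0) sK.
move=> h1 h2 h3; rewrite -(ler_pM2r KP0).
lra.
Qed.

(** This is the bound [n >= n_dp] when [X > L]: valleys serve at most [L * Tv]
    requests each, and the remainder must fit in the peaks. *)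
Lemma vehicles_ge_peak : T * (X * P - L * Tv S) <= n * Tp S.
Proof.
have T0 := trip_time_gt0 S; have P0 : 0 < P := period_gt0 S.
apply: (@le_of_slack _ (T * P)) => [|e e0]; first by rewrite mulr_gt0.
have [K [KP0 _ sK _]] := full_periods_horizon 0 e0.
have := @telescope_le R (fun x => T * cumul served x) 0 P
  (n * Tp S + T * (L * Tv S)) K.
rewrite !add0r [cumul _ 0]segint_eq0// mulr0 subr0 => tele.
have {tele} : T * cumul served (K%:R * P) <= K%:R * (n * Tp S + T * (L * Tv S)).
  apply: tele => i; rewrite !add0r.
  have := served_valley_le i; have := served_peak_le (i%:R * P + Tv S).
  have -> : i.+1%:R * P = i%:R * P + Tv S + Tp S by rewrite -natr1; ring.
  by move=> h1 /(ler_wpM2l (ltW T0)); lra.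
have K0 : 0 < K%:R :> R by rewrite -(pmulr_lgt0 _ P0).
have := ler_wpM2l (ltW T0) sK.
move=> h1 /(le_trans h1) h2; rewrite -(ler_pM2l K0); lra.
Qed.

(** Missing chargers have to be made up by charging in the peaks, when the
    fleet is also needed for driving. *)
Lemma vehicles_chargers_tradeoff :
  T * (X * P - L * Tv S) - a * L * T ^+ 2 + r * T * X * P
    <= n * Tp S + m * Tv S.
Proof.
have T0 := trip_time_gt0 S; have P0 : 0 < P := period_gt0 S.
apply: (@le_of_slack _ ((T + 1) * P)) => [|e e0].
  by rewrite mulr_gt0// addr_gt0.
have [K [KP0 _ sK cK]] := full_periods_horizon 0 e0.
have := @telescope_le R (fun x => cumul plugged x + T * cumul served x) 0 P
  (n * Tp S + m * Tv S + T * (L * Tv S) + a * L * T ^+ 2) K.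
rewrite !add0r [cumul _ 0]segint_eq0// [cumul _ 0]segint_eq0//.
rewrite mulr0 addr0 subr0 => tele.
have {tele} : cumul plugged (K%:R * P) + T * cumul served (K%:R * P) <=
    K%:R * (n * Tp S + m * Tv S + T * (L * Tv S) + a * L * T ^+ 2).
  by apply: tele => i; rewrite !add0r; exact: period_resources.
have K0 : 0 < K%:R :> R by rewrite -(pmulr_lgt0 _ P0).
have := ler_wpM2l (ltW T0) sK.
move=> h1 h2; rewrite -(ler_pM2l K0); lra.
Qed.

End ServiceLevel.
End InducedTrajectories.

(** * The choice of eta *)

Section DrivingVehicles.
Context {R : realType} {S : ev_system R}.
Implicit Types alpha : R.

Lemma n_dp_low alpha : 0 < alpha -> alpha * lambda_avg S <= lambda S ->
  n_dp S alpha = trip_time S * (alpha * lambda_avg S).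
Proof.
move=> alpha0 low; have L0 := lambda_gt0 S; have Tv0 := Tv_gt0 S.
have Tp0 := Tp_gt0 S; have a0 := lt_trans ltr01 (peak_factor_gt1 S).
have vE : alpha_v S alpha * lambda S = alpha * lambda_avg S.
  by rewrite /alpha_v /pos_part max_l ?subr_ge0//; field; rewrite !gt_eqF.
rewrite /n_dp /alpha_p vE subrr /pos_part maxxx mul0r addr0.
by field; rewrite !gt_eqF.
Qed.

Lemma n_dp_high alpha : lambda S < alpha * lambda_avg S ->
  n_dp S alpha = trip_time S
    * (alpha * lambda_avg S * (Tv S + Tp S) - lambda S * Tv S) / Tp S.
Proof.
move=> high; have L0 := lambda_gt0 S; have Tv0 := Tv_gt0 S.
have Tp0 := Tp_gt0 S; have a0 := lt_trans ltr01 (peak_factor_gt1 S).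
have vE : alpha_v S alpha = 1.
  rewrite /alpha_v /pos_part max_r ?subr_le0 ?(ltW high)//.
  by field; rewrite !gt_eqF.
rewrite /n_dp /alpha_p vE mul1r /pos_part max_l ?subr_ge0 ?(ltW high)//.
by field; rewrite !gt_eqF.
Qed.

End DrivingVehicles.

(** The claim on [n] decreases with [eta] while the claim on [m] increases.
    Any [eta_max] at which the former holds is therefore an admissible cap:
    below it, take the [eta] that makes the claim on [m] an equality, where the
    claim on [n] is [vehicles_chargers_tradeoff].  A negative [eta_max] is
    covered as well, since raising it to 0 weakens the claim on [n]. *)
Lemma eta_choice (R : realType) (S : ev_system R) (alpha : R) (pi : policy S)
    (eta_max : R) :
    0 < alpha -> (alpha%:E <= service_level pi)%E ->
    lambda S < alpha * lambda_avg S ->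
    trip_time S * (alpha * lambda_avg S * (Tv S + Tp S) - lambda S * Tv S)
      + rate_ratio S * trip_time S * (alpha * lambda_avg S) * Tp S
      - eta_max * lambda_avg S * trip_time S * Tv S
      - peak_factor S * lambda S * trip_time S ^+ 2
      <= (vehicles S)%:R * Tp S ->
  exists eta, [/\ 0 <= eta <= pos_part eta_max,
    n_dp S alpha + n_cp S alpha eta
      - trip_time S ^+ 2 * peak_factor S * lambda S / Tp S
      <= (vehicles S)%:R
    & n_cv S alpha eta <= (chargers S)%:R].
Proof.
move=> alpha0 hs high n_ge; have T0 := trip_time_gt0 S.
have A0 := lambda_avg_gt0 S; have Tv0 := Tv_gt0 S; have Tp0 := Tp_gt0 S.
have m_ge := chargers_ge_mean alpha0 hs.
have trade := vehicles_chargers_tradeoff alpha0 hs.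
set A := lambda_avg S in A0 high n_ge m_ge trade *.
set T := trip_time S in T0 n_ge m_ge trade *.
set r := rate_ratio S in n_ge m_ge trade *.
set m := (chargers S)%:R in m_ge trade *.
set n := (vehicles S)%:R in n_ge trade *.
(* The claim on [n] multiplied by [Tp S]. *)
have n_goal eta : T * (alpha * A * (Tv S + Tp S) - lambda S * Tv S)
      + r * T * (alpha * A) * Tp S - eta * A * T * Tv S
      - peak_factor S * lambda S * T ^+ 2 <= n * Tp S ->
    n_dp S alpha + n_cp S alpha eta
      - T ^+ 2 * peak_factor S * lambda S / Tp S <= n.
  rewrite -ler_pdivrMr//; apply: le_trans.
  rewrite n_dp_high// /n_cp -/A -/T -/r le_eqVlt; apply/orP; left; apply/eqP.
  by field; rewrite gt_eqF.
pose eta0 := (m - r * T * (alpha * A)) / (A * T).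
have AT0 : 0 < A * T by rewrite mulr_gt0.
have eta0_ge0 : 0 <= eta0 by rewrite divr_ge0 ?subr_ge0// ltW.
have eta0E : eta0 * A * T = m - r * T * (alpha * A).
  by rewrite /eta0; field; rewrite !gt_eqF.
have n_cvE eta : n_cv S alpha eta = r * T * (alpha * A) + eta * A * T.
  by rewrite /n_cv -/A -/T -/r; ring.
have [le_eta|lt_eta] := leP eta0 (pos_part eta_max).
  exists eta0; split; [by rewrite eta0_ge0|apply: n_goal|].
    by rewrite eta0E; lra.
  by rewrite n_cvE eta0E subrKC.
exists (pos_part eta_max); split.
- by rewrite lexx andbT /pos_part le_max lexx orbT.
- apply: n_goal; apply: le_trans n_ge.
  have /(ler_wpM2r (ltW (mulr_gt0 AT0 Tv0))) : eta_max <= pos_part eta_max.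
    by rewrite /pos_part le_max lexx.
  lra.
- rewrite n_cvE; have := ler_wpM2r (ltW AT0) (ltW lt_eta).
  by rewrite [eta0 * _]mulrA eta0E; lra.
Qed.

Theorem theorem3 (R : realType) (S : ev_system R) (alpha : R) (pi : policy S)
    (halpha : 0 < alpha < 1)
    (hratio : rate_ratio S * Tp S / Tv S < 1)
    (hservice : (alpha%:E <= service_level pi)%E) :
  exists eta w : R,
    [/\ 0 <= eta, 0 <= w,
        n_dp S alpha + n_cp S alpha eta
          - w * (trip_time S ^+ 2 * peak_factor S * lambda S / Tp S)
          <= (vehicles S)%:R
      & n_cv S alpha eta <= (chargers S)%:R]
    /\
    [/\ alpha * lambda_avg S <= lambda S -> eta = 0 /\ w = 0,
        lambda S < alpha * lambda_avg S
          <= lambda S / (1 - rate_ratio S * Tp S / Tv S) ->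
        0 <= eta <= pos_part
          (alpha - lambda S / lambda_avg S
             * (1 + peak_factor S * trip_time S / Tv S))
        /\ w = 1
      & lambda S / (1 - rate_ratio S * Tp S / Tv S) < alpha * lambda_avg S ->
        0 <= eta <= pos_part
          (alpha * rate_ratio S * Tp S / Tv S
             - peak_factor S * lambda S * trip_time S / (Tv S * lambda_avg S))
        /\ w = 1].
Proof.
have alpha0 : 0 < alpha by case/andP: halpha.
have T0 := trip_time_gt0 S; have L0 := lambda_gt0 S.
have A0 := lambda_avg_gt0 S; have Tv0 := Tv_gt0 S; have Tp0 := Tp_gt0 S.
have mean_n := vehicles_ge_mean alpha0 hservice.
have peak_n := vehicles_ge_peak alpha0 hservice.
have mean_m := chargers_ge_mean alpha0 hservice.
have threshold : lambda S <= lambda S / (1 - rate_ratio S * Tp S / Tv S).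
  have ratio0 : 0 <= rate_ratio S * Tp S / Tv S.
    have r0 := rate_ratio_gt0 S.
    by apply: divr_ge0; [apply: mulr_ge0|]; exact: ltW.
  by rewrite ler_pdivlMr ?subr_gt0// ler_piMr ?(ltW L0)// gerBl.
have [low|high] := leP (alpha * lambda_avg S) (lambda S).
  exists 0, 0; split; last first.
    split=> // /(le_lt_trans threshold)/(le_lt_trans low).
    by rewrite ltxx.
  split=> //.
    by rewrite n_dp_low// /n_cp; move: mean_n; lra.
  by rewrite /n_cv; move: mean_m; lra.
have [mid|top] :=
    leP (alpha * lambda_avg S) (lambda S / (1 - rate_ratio S * Tp S / Tv S)).
- have [|eta [eta_itv n_ge m_ge]] := @eta_choice R S alpha pi
    (alpha - lambda S / lambda_avg S * (1 + peak_factor S * trip_time S / Tv S))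
    alpha0 hservice high.
    (* At this cap the bound reads [(1 + r) * T * X * Tp <= n * Tp]. *)
    rewrite -(ler_pM2r Tp0) in mean_n; apply: le_trans mean_n.
    rewrite le_eqVlt; apply/orP; left; apply/eqP.
    by field; rewrite !gt_eqF.
  exists eta, 1; rewrite mul1r; split; first by split=> //; case/andP: eta_itv.
  by split.
- have [|eta [eta_itv n_ge m_ge]] := @eta_choice R S alpha pi
    (alpha * rate_ratio S * Tp S / Tv S
       - peak_factor S * lambda S * trip_time S / (Tv S * lambda_avg S))
    alpha0 hservice high.
    (* At this cap the charging demand in the peak cancels the boundary term,
       leaving [n_dp <= n]. *)
    apply: le_trans peak_n.
    rewrite le_eqVlt; apply/orP; left; apply/eqP.
    by field; rewrite !gt_eqF.
  exists eta, 1; rewrite mul1r; split; first by split=> //; case/andP: eta_itv.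
  by split.
Qed.
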